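(* Let $0\le\lambda<\gamma\le\delta$. If $\mathfrak{f}_1,\mathfrak{f}_2\in\mathcal{R}_H^0(\gamma,\delta,\lambda)$, then $\mathfrak{f}_1\ast\mathfrak{f}_2\in\mathcal{R}_H^0(\gamma,\delta,\lambda)$.
   Context: Let $\mathcal{U}=\{z\in\mathbb{C}:|z|<1\}$. $\mathcal{H}^0$ denotes the class of complex-valued harmonic functions $\mathfrak{f}=\mathfrak{s}+\overline{\mathfrak{t}}$ on $\mathcal{U}$, where $\mathfrak{s}(z)=z+\sum_{m\ge2}a_mz^m$ and $\mathfrak{t}(z)=\sum_{m\ge2}b_mz^m$ are analytic in $\mathcal{U}$. For real $0\le\lambda<\gamma\le\delta$, $\mathcal{R}_H^0(\gamma,\delta,\lambda)$ is the class of $\mathfrak{f}=\mathfrak{s}+\overline{\mathfrak{t}}\in\mathcal{H}^0$ such that for all $z\in\mathcal{U}$, $\mathrm{Re}\left[\gamma\mathfrak{s}'(z)+\delta z\mathfrak{s}''(z)+\frac{\delta-\gamma}{2}z^2\mathfrak{s}'''(z)-\lambda\right]>\left|\gamma\mathfrak{t}'(z)+\delta z\mathfrak{t}''(z)+\frac{\delta-\gamma}{2}z^2\mathfrak{t}'''(z)\right|$. For analytic $g(z)=\sum c_mz^m$, $h(z)=\sum d_mz^m$, the convolution is $(g\ast h)(z)=\sum c_md_mz^m$; for $\mathfrak{f}_i=\mathfrak{s}_i+\overline{\mathfrak{t}_i}$, $i=1,2$, the convolution is $\mathfrak{f}_1\ast\mathfrak{f}_2=\mathfrak{s}_1\ast\mathfrak{s}_2+\overline{\mathfrak{t}_1\ast\mathfrak{t}_2}$.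 *)

(* Defs.v *)
From HB Require Import structures.
From mathcomp Require Import all_boot all_order all_algebra.
From mathcomp Require Import all_classical all_reals all_analysis.
From mathcomp Require Export complex.
Export Order.TTheory GRing.Theory Num.Theory.

Set Implicit Arguments.
Unset Strict Implicit.
Unset Printing Implicit Defensive.

Local Open Scope ring_scope.
Local Open Scope complex_scope.

(* Equip R[i] with its standard (norm) topology and view it as a normed
   module over itself, so that [derive1] is the complex derivative. *)
Section ComplexNormed.
Variable R : rcfType.
HB.instance Definition _ := PseudoPointedMetric.copy R[i] R[i]^o.
HB.instance Definition _ := GRing.ComAlgebra.copy R[i] R[i]^o.
HB.instance Definition _ := Vector.copy R[i] R[i]^o.
HB.instance Definition _ := NormedModule.copy R[i] R[i]^o.
End ComplexNormed.

Section Defs.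
Variable R : realType.

Definition unit_disk : set R[i] := [set z | `|z| < 1].

Definition pser_partial (c : nat -> R[i]) (z : R[i]) : nat -> R[i] :=
  series (fun m => c m * z ^+ m).

Definition pser (c : nat -> R[i]) (z : R[i]) : R[i] :=
  limn (pser_partial c z).

(* H^0 : f = s + conj t with s(z) = z + sum_{m>=2} a_m z^m and
   t(z) = sum_{m>=2} b_m z^m analytic in U (power series converging in U).
   The harmonic function f is encoded by its coefficient sequences (a, b). *)
Definition H0 (a b : nat -> R[i]) : Prop :=
  [/\ a 0%N = 0, a 1%N = 1, b 0%N = 0, b 1%N = 0 &
      forall z, unit_disk z ->
        cvgn (pser_partial a z) /\ cvgn (pser_partial b z)].

Definition Lop (gamma delta : R) (g : R[i] -> R[i]) (z : R[i]) : R[i] :=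
  gamma%:C * derive1n 1 g z + delta%:C * z * derive1n 2 g z
  + ((delta - gamma) / 2)%:C * z ^+ 2 * derive1n 3 g z.

Definition RH0 (gamma delta lambda : R) (a b : nat -> R[i]) : Prop :=
  H0 a b /\
  forall z, unit_disk z ->
    Re (`| Lop gamma delta (pser b) z |) <
    Re (Lop gamma delta (pser a) z - lambda%:C).

Definition hconv (c d : nat -> R[i]) : nat -> R[i] := fun m => c m * d m.

End Defs.

(* Main.v *)
(* Put P[f] = gamma f' + delta z f'' + (delta - gamma) / 2 z^2 f''' - lambda. If
   s + conj t is in the class, then P[s + k t] has nonnegative real part whenever
   |k| = 1. Since s1*s2 + k t1*t2 is half the sum of (s1 + t1)*(s2 + k t2) and
   (s1 - t1)*(s2 - k t2), it suffices to treat the convolution of two analytic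
   functions F1, F2. Apart from the constant term, P multiplies coefficients by positive
   weights W n, so P[F1*F2] is the Hadamard product of P[F1] and F2 / z, whose
   coefficients are those of P[F2] divided by W n. Two positivity facts then conclude.
   First, if p and t have nonnegative real part, so has the average over |u| = 1 of
   2 Re p(w / u) Re t(u), which is Re (p*t)(w) + Re (p0 t0); the average is taken over
   roots of unity. Second, with the Fejer kernel for t, the Fejer means of p have
   nonnegative real part and, by summation by parts, so does the Hadamard product of p
   with any convex decreasing nonnegative sequence, in particular with 2 / W n for a
   suitable value at n = 0. *)
Require Import Defs.
From mathcomp Require Import all_boot all_order all_algebra.
From mathcomp Require Import all_classical all_reals all_analysis.
From mathcomp Require Import ring lra zify separable cyclic cyclotomic.
Local Open Scope ring_scope.
Local Open Scope complex_scope.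

Set Implicit Arguments.
Unset Strict Implicit.
Unset Printing Implicit Defensive.

Import ComplexField.Normc numFieldNormedType.Exports.
Local Open Scope classical_set_scope.
Local Notation Re := complex.Re.
Local Notation Im := complex.Im.

(** * The modulus as a real number, and real and imaginary parts *)

Section Modulus.
Variable R : realType.
Implicit Types (x y z : R[i]) (r : R).

Lemma normrE x : `|x| = (normc x)%:C.
Proof. by []. Qed.

Lemma normc_ge0 x : 0 <= normc x.
Proof. by rewrite -lecR -normrE normr_ge0. Qed.

Lemma normcD x y : normc (x + y) <= normc x + normc y.
Proof. exact: le_normcD. Qed.

Lemma normc_opp x : normc (- x) = normc x.
Proof. exact: normcN. Qed.

Lemma normcB x y : normc (x - y) <= normc x + normc y.
Proof. by rewrite -(normc_opp y); exact: normcD. Qed.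

Lemma normc_distC x y : normc (x - y) = normc (y - x).
Proof. by rewrite -normc_opp opprB. Qed.

Lemma normcX x n : normc (x ^+ n) = normc x ^+ n.
Proof. by elim: n => [|n IH]; rewrite ?normc1 // !exprS normcM IH. Qed.

Lemma normc_real r : normc r%:C = `|r|.
Proof. by rewrite /= expr0n addr0 sqrtr_sqr. Qed.

Lemma normc_nat n : normc (n%:R : R[i]) = n%:R.
Proof. by rewrite -(rmorph_nat (real_complex R)) normc_real normr_nat. Qed.

Lemma normc_gt0 x : (0 < normc x) = (x != 0).
Proof. by rewrite -ltcR -normrE normr_gt0. Qed.

Lemma normc_sum (I : Type) (s : seq I) (P : pred I) (F : I -> R[i]) :
  normc (\sum_(i <- s | P i) F i) <= \sum_(i <- s | P i) normc (F i).
Proof.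
elim/big_rec2: _ => [|i u v _ h]; first by rewrite normc0.
by apply: le_trans (normcD _ _) _; rewrite lerD2l.
Qed.

Lemma Re_le_normc x : `|Re x| <= normc x.
Proof. by rewrite -lecR -normrE; exact: normc_ge_Re. Qed.

Lemma Im_le_normc x : `|Im x| <= normc x.
Proof. by case: x => a b /=; rewrite -(sqrtr_sqr b) ler_wsqrtr // lerDr sqr_ge0. Qed.

Lemma normc_le_ReIm x : normc x <= `|Re x| + `|Im x|.
Proof.
rewrite {1}(complexE x); apply: le_trans (normcD _ _) _.
by rewrite normcM !normc_real /= expr0n expr1n add0r sqrtr1 mul1r.
Qed.

Lemma ReD x y : Re (x + y) = Re x + Re y.
Proof. by case: x y => [a b] [c d]. Qed.

Lemma ReN x : Re (- x) = - Re x.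
Proof. by case: x. Qed.

Lemma ReB x y : Re (x - y) = Re x - Re y.
Proof. by rewrite ReD ReN. Qed.

Lemma ImD x y : Im (x + y) = Im x + Im y.
Proof. by case: x y => [a b] [c d]. Qed.

Lemma ImB x y : Im (x - y) = Im x - Im y.
Proof. by case: x y => [a b] [c d]. Qed.

Lemma Re_realM r x : Re (r%:C * x) = r * Re x.
Proof. by case: x => a b /=; rewrite mul0r subr0. Qed.

Lemma Re_sum (I : Type) (s : seq I) (P : pred I) (F : I -> R[i]) :
  Re (\sum_(i <- s | P i) F i) = \sum_(i <- s | P i) Re (F i).
Proof. by elim/big_rec2: _ => [|i u v _ <-] //; rewrite ReD. Qed.

Lemma Im_sum (I : Type) (s : seq I) (P : pred I) (F : I -> R[i]) :
  Im (\sum_(i <- s | P i) F i) = \sum_(i <- s | P i) Im (F i).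
Proof. by elim/big_rec2: _ => [|i u v _ <-] //; rewrite ImD. Qed.

End Modulus.

(** * Convergence of complex sequences measured by the real modulus *)

Section Convergence.
Variable R : realType.
Implicit Types (l m z : R[i]) (u v : nat -> R[i]).

(** A positive element of [R[i]] is a positive real, so real radii [e] suffice. *)
Lemma cvg_normcP (T : Type) (F : set_system T) (FF : Filter F)
    (f : T -> R[i]) l :
  f @ F --> l <-> forall e : R, 0 < e -> \forall x \near F, normc (f x - l) < e.
Proof.
split=> [/cvgrPdist_lt h e e0|h].
  have := h e%:C; rewrite ltcR => /(_ e0).
  by apply: filterS => x; rewrite distrC -ltcR.
apply/cvgrPdist_lt => e; rewrite ltcE => /andP[/eqP ei er].
have /complex_realP[k ek] : (e : R[i]) \is Num.real.
  by move: e ei er => [a b] /= -> _; rewrite complex_real.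
move: er; rewrite ek /= => /h; apply: filterS => x hx.
by rewrite distrC; rewrite -ltcR in hx.
Qed.

(* Equivalent to [u @ \oo --> l] by [cvg_normcP]; as a plain predicate it avoids
   comparing the several topological structures carried by R[i]. *)
Definition cvgC u l : Prop :=
  forall e : R, 0 < e -> \forall n \near \oo, normc (u n - l) < e.

(** Asymptotic nonnegativity is all that truncated series provide. *)
Lemma cvgC_Re_ge0 u l : cvgC u l ->
  (forall e : R, 0 < e -> \forall n \near \oo, - e <= Re (u n)) -> 0 <= Re l.
Proof.
move=> ul h; apply/ler_addgt0Pr => e e0.
have e20 : 0 < e / 2 by lra.
near \oo => n.
have h1 : normc (u n - l) < e / 2 by near: n; exact: ul.
have h2 : - (e / 2) <= Re (u n) by near: n; exact: h.
have := Re_le_normc (u n - l); rewrite ReB ler_norml => /andP[h3 h4].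
by lra.
Unshelve. all: by end_near. Qed.

Lemma cvgC_normc_le u l m (K : R) : cvgC u l ->
  (\forall n \near \oo, normc (u n - m) <= K) -> normc (l - m) <= K.
Proof.
move=> ul h; apply/ler_addgt0Pr => e e0.
near \oo => n.
have h1 : normc (u n - l) < e by near: n; exact: ul.
have h2 : normc (u n - m) <= K by near: n.
have := normcD (l - u n) (u n - m); rewrite addrA subrK (normc_distC l).
by lra.
Unshelve. all: by end_near. Qed.

Lemma cvgC_add u v l m : cvgC u l -> cvgC v m ->
  cvgC (fun n => u n + v n) (l + m).
Proof.
move=> ul vm e e0.
have e20 : 0 < e / 2 by lra.
near=> n.
have h1 : normc (u n - l) < e / 2 by near: n; exact: ul.
have h2 : normc (v n - m) < e / 2 by near: n; exact: vm.
have := normcD (u n - l) (v n - m); rewrite addrACA -opprD; lra.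
Unshelve. all: by end_near. Qed.

Lemma cvgC_scale (k : R[i]) u l : cvgC u l -> cvgC (fun n => k * u n) (k * l).
Proof.
move=> ul e e0.
have k0 : 0 < normc k + 1 by have := normc_ge0 k; lra.
have ek0 : 0 < e / (normc k + 1) by rewrite divr_gt0.
near=> n; rewrite -mulrBr normcM.
have : normc (u n - l) < e / (normc k + 1) by near: n; exact: ul.
rewrite ltr_pdivlMr //; have := normc_ge0 (u n - l); nra.
Unshelve. all: by end_near. Qed.

Lemma cvgC_shiftS u l : cvgC u l -> cvgC (fun n => u n.+1) (l).
Proof.
move=> ul e /ul[N _ hN].
by exists N => // n /= Nn; apply: hN; exact: leqW.
Qed.

Lemma cvgC_unshiftS u l : cvgC (fun n => u n.+1) (l) -> cvgC u l.
Proof.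
move=> ul e /ul[N _ hN].
by exists N.+1 => // -[|n] //= Nn; exact: hN.
Qed.

Lemma eq_cvgC u v l : u =1 v -> cvgC u l -> cvgC v l.
Proof. by move=> /funext ->. Qed.

Lemma pser_lim (c : nat -> R[i]) z l : cvgC (pser_partial c z) l -> pser c z = l.
Proof. by move=> /cvg_normcP; exact: cvg_lim. Qed.

End Convergence.

(** * Power series in the unit disk, controlled by the growth of their coefficients *)

Section PowerSeries.
Variable R : realType.
Implicit Types (c d : nat -> R[i]) (z w h : R[i]) (r x : R).

(** Equivalent to convergence of the series throughout the disk, but preserved by shifts, scalings
    and Hadamard products through elementary estimates. *)
Definition disk_bounded c : Prop :=
  forall r, 0 <= r -> r < 1 -> exists C : R, forall n, normc (c n) * r ^+ n <= C.

Lemma pser_partialE c z n :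
  pser_partial c z n = \sum_(0 <= m < n) c m * z ^+ m.
Proof. by []. Qed.

Lemma cvg_disk_bounded c :
  (forall z, unit_disk z -> cvgn (pser_partial c z)) -> disk_bounded c.
Proof.
move=> cc r r0 r1; have /cc/cvg_ex[l /cvg_normcP/(_ 1 ltr01)[N _ hN]] : unit_disk (r%:C).
  by rewrite /unit_disk /= normrE ltcR normc_real ger0_norm.
pose u n := normc (c n) * r ^+ n.
have u0 n : 0 <= u n by rewrite mulr_ge0 ?normc_ge0 ?exprn_ge0.
(* From [N] on, a term is the difference of two partial sums within 1 of the limit, whence 2; the
   sum bounds the finitely many earlier terms. *)
exists (2 + \sum_(i < N) u i) => n; rewrite -/(u n); have [Nn|nN] := leqP N n.
  apply: ler_wpDr; first exact: sumr_ge0.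
  have h1 := hN _ Nn; have h2 := hN _ (leqW Nn).
  have -> : u n = normc (pser_partial c r%:C n.+1 - pser_partial c r%:C n).
    rewrite !pser_partialE big_nat_recr //= [_ + _ - _]addrC addKr normcM normcX.
    by rewrite normc_real ger0_norm.
  have := normcB (pser_partial c r%:C n.+1 - l) (pser_partial c r%:C n - l).
  rewrite opprB addrA subrK; rewrite /= in h1 h2; lra.
rewrite (bigD1 (Ordinal nN)) //= -[X in X <= _]addr0 addrCA lerD2l addr_ge0 //.
exact: sumr_ge0.
Qed.

Lemma geometric_sum_le x m n : 0 <= x -> x < 1 ->
  \sum_(m <= k < n) x ^+ k <= x ^+ m / (1 - x).
Proof.
move=> x0 x1; have x1' : 0 < 1 - x by lra.
rewrite ler_pdivlMr // mulr_suml.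
under eq_bigr do rewrite mulrBr mulr1 -exprSr.
have [mn|nm] := leqP m n; last by rewrite big_geq ?exprn_ge0 // ltnW.
rewrite (@telescope_sumr_eq _ m n (fun k => - x ^+ k)) //; last first.
  by move=> k _; rewrite opprK addrC.
by rewrite opprK addrC gerDl oppr_le0 exprn_ge0.
Qed.

(** Each of the powers [x ^+ k] with [k < n] is at least [x ^+ n], and together they sum to at most
    [(1 - x)^-1]. *)
Lemma mulrn_expr_le x n : 0 <= x -> x < 1 -> n%:R * x ^+ n <= (1 - x)^-1.
Proof.
move=> x0 x1; have := geometric_sum_le 0 n x0 x1; rewrite expr0 div1r.
apply: le_trans; rewrite -[n in n%:R]subn0 mulr_natl -sumr_const_nat.
by apply: ler_sum_nat => i /andP[_ ni]; apply: ler_wiXn2l; rewrite ?(ltW x1) ?(ltnW ni).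
Qed.

(* An intermediate radius: [((1 + r) / 2) ^ 2 >= r] since [(1 - r) ^ 2 >= 0]. *)
Lemma disk_bounded_geometric c r : disk_bounded c -> 0 <= r -> r < 1 ->
  exists C x : R, [/\ 0 <= C, 0 <= x, x < 1 &
    forall n, normc (c n) * r ^+ n <= C * x ^+ n].
Proof.
move=> bc r0 r1; pose s := (1 + r) / 2; have s1 : s < 1 by rewrite /s; lra.
have s0 : 0 < s by rewrite /s; lra.
have [C hC] := bc s (ltW s0) s1; exists C, s; split=> //; last 2 first.
- exact: ltW.
- move=> n; have rs : r <= s * s by rewrite /s; nra.
  apply: (@le_trans _ _ (normc (c n) * (s * s) ^+ n)).
    by apply: ler_wpM2l; rewrite ?normc_ge0 // lerXn2r ?nnegrE // mulr_ge0 // ltW.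
  by rewrite exprMn mulrA ler_wpM2r ?exprn_ge0 // ltW.
by apply: le_trans (hC 0%N); rewrite mulr_ge0 ?normc_ge0 ?exprn_ge0 // ltW.
Qed.

Lemma disk_bounded_sum c r : disk_bounded c -> 0 <= r -> r < 1 ->
  exists C : R, forall n, \sum_(0 <= k < n) normc (c k) * r ^+ k <= C.
Proof.
move=> bc r0 r1; have [C [x [C0 x0 x1 h]]] := disk_bounded_geometric bc r0 r1.
exists (C * (x ^+ 0 / (1 - x))) => n.
apply: (@le_trans _ _ (\sum_(0 <= k < n) C * x ^+ k)); first exact: ler_sum.
by rewrite -mulr_sumr ler_wpM2l // geometric_sum_le.
Qed.

Lemma cvgn_ReIm (u : nat -> R[i]) :
  cvgn (fun n => Re (u n) : R) -> cvgn (fun n => Im (u n) : R) -> cvgn u.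
Proof.
move=> /cvg_ex[a /cvgrPdist_lt ha] /cvg_ex[b /cvgrPdist_lt hb].
apply/cvg_ex; exists (a +i* b); apply/cvg_normcP => e e0.
have e20 : 0 < e / 2 by lra.
near=> n; apply: le_lt_trans (normc_le_ReIm _) _; rewrite ReB ImB /=.
have h1 : `|a - Re (u n)| < e / 2 by near: n; exact: ha.
have h2 : `|b - Im (u n)| < e / 2 by near: n; exact: hb.
rewrite distrC (distrC _ b); lra.
Unshelve. all: by end_near. Qed.

Lemma normc_term_le c z r n : normc z <= r -> normc (c n * z ^+ n) <= normc (c n) * r ^+ n.
Proof.
move=> zr; rewrite normcM normcX ler_wpM2l ?normc_ge0 // lerXn2r // nnegrE ?normc_ge0 //.
exact: le_trans (normc_ge0 z) zr.
Qed.

Lemma disk_bounded_cvg c z : disk_bounded c -> normc z < 1 ->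
  cvgC (pser_partial c z) (pser c z).
Proof.
move=> bc z1; suff: cvgn (pser_partial c z) by move/cvg_normcP.
have [C [x [C0 x0 x1 h]]] := disk_bounded_geometric bc (normc_ge0 z) z1.
have geo : cvgn (series (geometric C x)).
  by apply: is_cvg_geometric_series; rewrite ger0_norm.
have cvr (v : nat -> R) : (forall n, `|v n| <= C * x ^+ n) -> cvgn (series v).
  move=> hv; apply: normed_cvg; apply: series_le_cvg geo => //= n.
  by rewrite mulr_ge0 ?exprn_ge0.
have ht n : normc (c n * z ^+ n) <= C * x ^+ n.
  by apply: le_trans (h n); exact: normc_term_le.
apply: cvgn_ReIm.
  rewrite (_ : (fun n => _) = series (fun n => Re (c n * z ^+ n) : R)).
    by apply: cvr => n; apply: le_trans (Re_le_normc _) _.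
  by apply/funext => n; rewrite pser_partialE Re_sum.
rewrite (_ : (fun n => _) = series (fun n => Im (c n * z ^+ n) : R)).
  by apply: cvr => n; apply: le_trans (Im_le_normc _) _.
by apply/funext => n; rewrite pser_partialE Im_sum.
Qed.

(** The geometric majorant of the terms depends on [r] only, so its tail bounds the error for all
    [z] at once. *)
Lemma pser_partial_unif c r (e : R) : disk_bounded c -> 0 <= r -> r < 1 -> 0 < e ->
  \forall n \near \oo, forall z, normc z <= r ->
    normc (pser c z - pser_partial c z n) <= e.
Proof.
move=> bc r0 r1 e0.
have [C [x [C0 x0 x1 h]]] := disk_bounded_geometric bc r0 r1.
have : geometric (C / (1 - x)) x @ \oo --> 0.
  by apply: cvg_geometric; rewrite ger0_norm.
move=> /cvgrPdist_le/(_ e e0); apply: filterS => n /=.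
rewrite sub0r normrN => hn z zr.
have z1 : normc z < 1 by exact: le_lt_trans r1.
apply: (cvgC_normc_le (disk_bounded_cvg bc z1)).
near=> m; have nm : (n <= m)%N by near: m; exact: nbhs_infty_ge.
rewrite !pser_partialE (@big_cat_nat _ _ _ n 0%N m) //= addrAC subrr add0r.
apply: le_trans hn; apply: le_trans (ler_norm _).
apply: le_trans (normc_sum _ _ _) _.
apply: (@le_trans _ _ (\sum_(n <= k < m) C * x ^+ k)).
  by apply: ler_sum => k _; apply: le_trans (h k); exact: normc_term_le.
rewrite -mulr_sumr -mulrA ler_wpM2l // (mulrC _ (x ^+ n)).
exact: geometric_sum_le.
Unshelve. all: by end_near. Qed.

Lemma disk_boundedD c d : disk_bounded c -> disk_bounded d ->
  disk_bounded (fun n => c n + d n).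
Proof.
move=> bc bd r r0 r1; have [C hC] := bc r r0 r1; have [D hD] := bd r r0 r1.
exists (C + D) => n; apply: le_trans (lerD (hC n) (hD n)).
by rewrite -mulrDl ler_wpM2r ?exprn_ge0 ?normcD.
Qed.

Lemma disk_bounded_le c d (K : R) : 0 <= K ->
  (forall n, normc (c n) <= K * normc (d n)) -> disk_bounded d -> disk_bounded c.
Proof.
move=> K0 cd bd r r0 r1; have [C hC] := bd r r0 r1.
exists (K * C) => n; apply: le_trans (ler_wpM2l K0 (hC n)).
by rewrite mulrA ler_wpM2r ?exprn_ge0.
Qed.

Lemma disk_boundedZ (k : R[i]) c : disk_bounded c -> disk_bounded (fun n => k * c n).
Proof.
by apply: disk_bounded_le (normc_ge0 k) _ => n; rewrite normcM.
Qed.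

Lemma disk_bounded_cst (k : R[i]) : disk_bounded (fun=> k).
Proof.
move=> r r0 r1; exists (normc k) => n.
by rewrite ler_piMr ?normc_ge0 // exprn_ile1 // ltW.
Qed.

(** The geometric bound for [c] at radius [r] leaves a factor [x ^+ n] with [x < 1], and [x] then
    serves as the radius for [d]. *)
Lemma disk_boundedM c d : disk_bounded c -> disk_bounded d ->
  disk_bounded (fun n => c n * d n).
Proof.
move=> bc bd r r0 r1.
have [C [x [C0 x0 x1 hC]]] := disk_bounded_geometric bc r0 r1.
have [D hD] := bd x x0 x1.
exists (C * D) => n; rewrite normcM mulrAC mulrC.
apply: le_trans (ler_wpM2l (normc_ge0 _) (hC n)) _.
by rewrite mulrCA ler_wpM2l.
Qed.

Lemma disk_bounded_shift c : disk_bounded c -> disk_bounded (fun n => c n.+1).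
Proof.
(* The larger radius [s] is positive even when [r = 0], so one factor [s] can be divided out. *)
move=> bc r r0 r1; pose s := (1 + r) / 2; have s1 : s < 1 by rewrite /s; lra.
have s0 : 0 < s by rewrite /s; lra.
have [C hC] := bc s (ltW s0) s1; exists (C / s) => n.
rewrite ler_pdivlMr // -mulrA; apply: le_trans (hC n.+1).
rewrite ler_wpM2l ?normc_ge0 // exprSr ler_wpM2r ?(ltW s0) //.
by rewrite lerXn2r ?nnegrE ?(ltW s0) // /s; lra.
Qed.

Lemma disk_bounded_natmul c : disk_bounded c -> disk_bounded (fun n => n%:R * c n).
Proof.
apply: disk_boundedM => r r0 r1; exists (1 - r)^-1 => n.
by rewrite normc_nat mulrn_expr_le.
Qed.

End PowerSeries.

(** * Termwise differentiation of power series *)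

Section Derivative.
Variable R : realType.
Implicit Types (c : nat -> R[i]) (z w h : R[i]) (r : R).

Definition dcoef c n := n.+1%:R * c n.+1.

Lemma disk_bounded_dcoef c : disk_bounded c -> disk_bounded (dcoef c).
Proof.
by move=> /disk_bounded_natmul/disk_bounded_shift.
Qed.

(** Induction on [m] through a recursion for the remainder. The form [r ^+ m / r ^+ 2] avoids the
    exponent [m - 2]. *)
Lemma expr_taylor1_le z h r m : 0 < r -> r <= 1 -> normc z <= r -> normc (z + h) <= r ->
  normc ((z + h) ^+ m - z ^+ m - h * (m%:R * z ^+ m.-1)) <=
  normc h ^+ 2 / r ^+ 2 * (m%:R ^+ 2 * r ^+ m).
Proof.
move=> r0 r1 zr zhr; elim: m => [|m IH].
  by rewrite !expr0 expr0n !mul0r !mulr0 subrr subr0 normc0.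
have -> : (z + h) ^+ m.+1 - z ^+ m.+1 - h * (m.+1%:R * z ^+ m) =
    (z + h) * ((z + h) ^+ m - z ^+ m - h * (m%:R * z ^+ m.-1)) +
    h ^+ 2 * (m%:R * z ^+ m.-1).
  case: m {IH} => [|m]; first by rewrite !expr0 !expr1; ring.
  by rewrite !exprS /= -[in m.+2%:R]natr1; ring.
apply: le_trans (normcD _ _) _; rewrite normcM.
apply: le_trans (lerD (ler_pM (normc_ge0 _) (normc_ge0 _) zhr IH) (lexx _)) _.
rewrite !normcM !normcX normc_nat -expr2.
have h1 : m%:R * normc z ^+ m.-1 <= r ^+ m.+1 / r ^+ 2 * m%:R.
  case: m {IH} => [|m]; first by rewrite mul0r mulr0.
  rewrite /= mulrC ler_wpM2r // -addn2 exprD mulfK ?expf_neq0 ?gt_eqF //.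
  by rewrite lerXn2r ?nnegrE ?normc_ge0 // ltW.
apply: le_trans (lerD (lexx _) (ler_wpM2l _ h1)) _; first by rewrite exprn_ge0 ?normc_ge0.
(* Here [(m + 1)^2] is split as [m^2 + m + (m + 1)]; the last summand is slack. *)
have -> : normc h ^+ 2 / r ^+ 2 * (m.+1%:R ^+ 2 * r ^+ m.+1) =
  r * (normc h ^+ 2 / r ^+ 2 * (m%:R ^+ 2 * r ^+ m)) +
  normc h ^+ 2 * (r ^+ m.+1 / r ^+ 2 * m%:R) +
  normc h ^+ 2 / r ^+ 2 * (r ^+ m.+1 * m.+1%:R).
  by rewrite (exprS r m) -natr1; ring.
by rewrite lerDl !mulr_ge0 ?invr_ge0 ?sqr_ge0 ?exprn_ge0 ?normc_ge0 // ltW.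
Qed.

Lemma pser_taylor1 c r : disk_bounded c -> 0 < r -> r < 1 ->
  exists K : R, forall z h, normc z <= r -> normc (z + h) <= r ->
    normc (pser c (z + h) - pser c z - h * pser (dcoef c) z) <= normc h ^+ 2 * K.
Proof.
move=> bc r0 r1.
have bc2 := disk_bounded_natmul (disk_bounded_natmul bc).
have [C hC] := disk_bounded_sum bc2 (ltW r0) r1.
exists (C / r ^+ 2) => z h zr zhr.
have z1 : normc z < 1 by exact: le_lt_trans r1.
have zh1 : normc (z + h) < 1 by exact: le_lt_trans r1.
have lim1 := disk_bounded_cvg bc zh1.
have lim2 := disk_bounded_cvg bc z1.
have lim3 := disk_bounded_cvg (disk_bounded_dcoef bc) z1.
(* The sums of [c] take one more term than that of [dcoef c], because differentiation lowers degrees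
   by one. *)
have Dlim : cvgC (fun n => pser_partial c (z + h) n.+1 - pser_partial c z n.+1
    - h * pser_partial (dcoef c) z n)
    (pser c (z + h) - pser c z - h * pser (dcoef c) z).
  rewrite -[- pser c z]mulN1r -[- (h * _)]mulNr.
  apply: eq_cvgC (cvgC_add (cvgC_add (cvgC_shiftS lim1)
    (cvgC_scale (-1) (cvgC_shiftS lim2))) (cvgC_scale (- h) lim3)) => n.
  by rewrite mulN1r mulNr.
rewrite -[X in normc X]subr0; apply: (cvgC_normc_le Dlim).
near=> n; rewrite subr0.
have -> : pser_partial c (z + h) n.+1 - pser_partial c z n.+1
    - h * pser_partial (dcoef c) z n =
  \sum_(0 <= m < n.+1) c m * ((z + h) ^+ m - z ^+ m - h * (m%:R * z ^+ m.-1)).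
  rewrite !pser_partialE (_ : \sum_(0 <= m < n) dcoef c m * z ^+ m =
    \sum_(0 <= m < n.+1) c m * (m%:R * z ^+ m.-1)); last first.
    rewrite big_nat_recl // mul0r mulr0 add0r; apply: eq_bigr => m _.
    by rewrite /dcoef /=; ring.
  by rewrite mulr_sumr -!sumrB; apply: eq_bigr => m _; ring.
apply: le_trans (normc_sum _ _ _) _.
rewrite mulrA mulrAC; apply: le_trans (ler_wpM2l _ (hC n.+1)); last first.
  by rewrite mulr_ge0 ?invr_ge0 ?sqr_ge0.
rewrite mulr_sumr; apply: ler_sum => m _; rewrite normcM.
apply: le_trans (ler_wpM2l (normc_ge0 _) (expr_taylor1_le m r0 (ltW r1) zr zhr)) _.
by rewrite !normcM normc_nat le_eqVlt; apply/orP; left; apply/eqP; ring.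
Unshelve. all: by end_near. Qed.

(** Agreement of [g] with the series is asked inside the disk only, so that the lemma can be
    iterated: a derivative is known to be a power series only there. *)
Lemma derive1_pser (g : R[i] -> R[i]) c : disk_bounded c ->
  (forall z, normc z < 1 -> g z = pser c z) ->
  forall z, normc z < 1 -> derive1 g z = pser (dcoef c) z.
Proof.
move=> bc gc z z1; apply: cvg_lim => //; apply/cvg_normcP => e e0.
pose r := (1 + normc z) / 2.
have r1 : r < 1 by rewrite /r; lra.
have r0 : 0 < r by rewrite /r; have := normc_ge0 z; lra.
have zr : normc z <= r by rewrite /r; lra.
have [K hK] := pser_taylor1 bc r0 r1.
have K1 : 0 < `|K| + 1 by rewrite ltr_wpDl.
(* The first bound on [h] keeps [z + h] within radius [r]; the second brings the remainder, after
   division by [h], below [e]. *)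
have d0 : 0 < Num.min (r - normc z) (e / (`|K| + 1)).
  by rewrite lt_min divr_gt0 // andbT /r; lra.
near=> h.
have h0 : h != 0 by near: h; exact: nbhs_dnbhs_neq.
have : `|h| < (Num.min (r - normc z) (e / (`|K| + 1)))%:C.
  by near: h; apply: dnbhs0_lt; rewrite ltcR.
rewrite normrE ltcR lt_min => /andP[hr he].
have zhr : normc (z + h) <= r by apply: le_trans (normcD _ _) _; lra.
rewrite (addrC h) !gc ?(le_lt_trans zhr) //.
have nh : 0 < normc h by rewrite normc_gt0.
have -> : h^-1 *: (pser c (z + h) - pser c z) - pser (dcoef c) z =
   h^-1 * (pser c (z + h) - pser c z - h * pser (dcoef c) z).
  by rewrite mulrBr mulKf.
rewrite normcM normcV mulrC ltr_pdivrMr //.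
apply: le_lt_trans (hK _ _ zr zhr) _.
rewrite expr2 -mulrA mulrC ltr_pM2r //.
rewrite ltr_pdivlMr // in he; apply: le_lt_trans he.
by rewrite ler_wpM2l ?(ltW nh) //; have := ler_norm K; lra.
Unshelve. all: by end_near. Qed.

Lemma derive1n_pser c k : disk_bounded c ->
  forall z, normc z < 1 -> derive1n k (pser c) z = pser (iter k dcoef c) z.
Proof.
move=> bc; have bk j : disk_bounded (iter j dcoef c).
  by elim: j => //= j; exact: disk_bounded_dcoef.
elim: k => // k IH z z1; rewrite /derive1n /=; exact: (derive1_pser (bk k)).
Qed.

Lemma pserD c d z : disk_bounded c -> disk_bounded d -> normc z < 1 ->
  pser (fun n => c n + d n) z = pser c z + pser d z.
Proof.
move=> bc bd z1; apply: pser_lim.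
apply: eq_cvgC (cvgC_add (disk_bounded_cvg bc z1) (disk_bounded_cvg bd z1)) => n.
by rewrite !pser_partialE -big_split; apply: eq_bigr => m _ /=; rewrite mulrDl.
Qed.

Lemma pserZ k c z : disk_bounded c -> normc z < 1 ->
  pser (fun n => k * c n) z = k * pser c z.
Proof.
move=> bc z1; apply: pser_lim.
apply: eq_cvgC (cvgC_scale k (disk_bounded_cvg bc z1)) => n.
by rewrite !pser_partialE mulr_sumr; apply: eq_bigr => m _ /=; rewrite mulrA.
Qed.

Definition mulX_coef c n := if n is m.+1 then c m else 0.

Lemma disk_bounded_mulX c : disk_bounded c -> disk_bounded (mulX_coef c).
Proof.
move=> bc r r0 r1; have [C hC] := bc r r0 r1; exists `|C| => -[|n]; first by rewrite normc0 mul0r.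
rewrite [mulX_coef _ _]/= exprSr mulrA; apply: le_trans (ler_norm C); apply: le_trans (hC n).
by rewrite ler_piMr ?(ltW r1) // mulr_ge0 ?normc_ge0 ?exprn_ge0.
Qed.

Lemma pser_mulX c z : disk_bounded c -> normc z < 1 ->
  pser (mulX_coef c) z = z * pser c z.
Proof.
move=> bc z1; apply: pser_lim; apply: cvgC_unshiftS.
apply: eq_cvgC (cvgC_scale z (disk_bounded_cvg bc z1)) => n.
rewrite !pser_partialE big_nat_recl // mul0r add0r mulr_sumr.
by apply: eq_bigr => m _ /=; rewrite exprS mulrCA.
Qed.

End Derivative.

(** * The differential operator as a multiplier of coefficients *)

Section Operator.
Variable R : realType.
Implicit Types (a b : nat -> R[i]) (gamma delta : R) (z : R[i]).

(* [gamma m + delta m (m-1) + (delta-gamma)/2 m (m-1) (m-2)] with [m = n + 1]. *)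
Definition Lop_weight gamma delta n : R :=
  n.+1%:R ^+ 2 * (2 * gamma + n%:R * (delta - gamma)) / 2.

Definition Lop_coef gamma delta a n := (Lop_weight gamma delta n)%:C * a n.+1.

Lemma disk_bounded_Lop gamma delta a : disk_bounded a ->
  disk_bounded (Lop_coef gamma delta a).
Proof.
move=> ba; have bn : disk_bounded (fun n => n%:R : R[i]).
  by under eq_fun do rewrite -[_%:R]mulr1; exact/disk_bounded_natmul/disk_bounded_cst.
apply: disk_boundedM (disk_bounded_shift ba).
have -> : (fun n => (Lop_weight gamma delta n)%:C) = fun n =>
    n.+1%:R * n.+1%:R * (gamma%:C + ((delta - gamma) / 2)%:C * n%:R) :> R[i].
  apply/funext => n; rewrite /Lop_weight.
  by rewrite !(rmorphM, rmorphD, rmorphB, fmorphV, rmorphXn, rmorph_nat) /=; field.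
apply: disk_boundedM; first by apply: disk_boundedM; exact: (disk_bounded_shift bn).
apply: disk_boundedD; first exact: disk_bounded_cst.
exact: disk_boundedZ.
Qed.

Lemma Lop_pser gamma delta a z : disk_bounded a -> normc z < 1 ->
  Lop gamma delta (pser a) z = pser (Lop_coef gamma delta a) z.
Proof.
move=> ba z1; rewrite /Lop !derive1n_pser //=.
have b1 := disk_bounded_dcoef ba; have b2 := disk_bounded_dcoef b1.
have b3 := disk_bounded_dcoef b2.
have m2 := disk_bounded_mulX b2.
have m3 := disk_bounded_mulX (disk_bounded_mulX b3).
rewrite expr2 -!mulrA -!pser_mulX //; last exact: disk_bounded_mulX.
rewrite -!pserZ // -!pserD //; try exact: disk_boundedZ; last first.
  by apply: disk_boundedD; exact: disk_boundedZ.
congr (pser _ z); apply/funext => n.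
rewrite /Lop_coef /Lop_weight.
rewrite !(rmorphM, rmorphD, rmorphB, fmorphV, rmorphXn, rmorph_nat) /=.
(* The second and third derivative terms start at degrees 1 and 2, so the two lowest coefficients
   are computed apart. *)
case: n => [|[|n]]; rewrite /dcoef /=.
- by field.
- by field.
- by rewrite -!natr1; field.
Qed.

End Operator.

(** * Averages of truncated series over roots of unity *)

Section RootsOfUnity.
Variable R : realType.
Implicit Types (p t : nat -> R[i]) (u : R[i]).

(** [R[i]] is algebraically closed and [X^n - 1] is separable, so there are [n] distinct roots of
    unity, which forces one to be primitive. *)
Lemma primitive_root_exists n : (0 < n)%N -> exists w : R[i], n.-primitive_root w.
Proof.
pose P : {poly R[i]} := 'X^n - 1; have [r DP] := closed_field_poly_normal P.
move=> n0; rewrite (monicP _) ?monicXnsubC // scale1r in DP.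
have rn1 : all n.-unity_root r by apply/allP=> z; rewrite -root_prod_XsubC -DP.
have sz_r : (n < (size r).+1)%N by rewrite -(size_prod_XsubC r id) -DP size_XnsubC.
have [|z] := hasP (has_prim_root n0 rn1 _ sz_r); last by exists z.
by rewrite -separable_prod_XsubC -DP separable_Xn_sub_1 // pnatr_eq0 -lt0n.
Qed.

Lemma normc_unity_root u n : (0 < n)%N -> u ^+ n = 1 -> normc u = 1.
Proof.
move=> n0 un; apply/eqP; rewrite -(@pexpr_eq1 _ _ n) ?normc_ge0 //.
by rewrite -normcX un normc1.
Qed.

Lemma conjc_unit u : normc u = 1 -> conjc u = u^-1.
Proof.
move=> u1; rewrite invc_norm normrE u1.
by rewrite (_ : 1%:C = 1 :> R[i]) // expr1n invr1 mul1r.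
Qed.

Lemma sum_unity_root_pow u n : u ^+ n = 1 -> u != 1 -> \sum_(k < n) u ^+ k = 0.
Proof.
move=> un u1; have := subrX1 u n; rewrite un subrr => /esym/eqP.
by rewrite mulf_eq0 subr_eq0 (negPf u1) => /eqP.
Qed.

Lemma Re_conjc u : Re (conjc u) = Re u. Proof. by case: u. Qed.

(** In the average over the circle, the first summand will give the Hadamard product and the second
    only the constant terms. *)
Lemma ReM_ReM u v : Re u * Re v = (Re (u * v) + Re (u * conjc v)) / 2 :> R.
Proof. by case: u v => [a b] [c d] /=; lra. Qed.

Section Averages.
Variables (w : R[i]) (N : nat).
Hypotheses (w_prim : N.-primitive_root w).

Let N0 : (0 < N)%N := prim_order_gt0 w_prim.

(** Orthogonality of the characters of the cyclic group of order [N]. *)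
Lemma sum_prim_root_ratio n m : (n < N)%N -> (m < N)%N ->
  \sum_(k < N) (w ^- k) ^+ n * (w ^+ k) ^+ m = (N * (n == m))%:R.
Proof.
move=> nN mN; have w0 : w != 0.
  apply: contra_eq_neq (prim_expr_order w_prim) => ->.
  by rewrite expr0n gtn_eqF // eq_sym oner_eq0.
under eq_bigr => k _ do rewrite -exprVn -!exprM ![(k * _)%N]mulnC !exprM -exprMn.
have [->|nm] := eqVneq n m.
  rewrite exprVn mulVf ?expf_neq0 //; under eq_bigr do rewrite expr1n.
  by rewrite sumr_const card_ord muln1.
rewrite muln0; apply: sum_unity_root_pow.
  rewrite exprMn (exprAC w^-1) (exprAC w) exprVn (prim_expr_order w_prim).
  by rewrite invr1 !expr1n mulr1.
rewrite exprVn mulrC; apply: contra nm => /eqP/divr1_eq/eqP.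
by rewrite (eq_prim_root_expr w_prim) !modn_small // eq_sym.
Qed.

(** A discrete Parseval identity; [M <= N] prevents aliasing between exponents. *)
Lemma mean_pser_partialM p t M : (M <= N)%N ->
  \sum_(k < N) pser_partial p (w ^- k) M * pser_partial t (w ^+ k) M =
  N%:R * pser_partial (fun n => p n * t n) 1 M.
Proof.
move=> MN; pose x k n m := (p n * (w ^- k) ^+ n) * (t m * (w ^+ k) ^+ m).
transitivity (\sum_(k < N) \sum_(n < M) \sum_(m < M) x k n m).
  apply: eq_bigr => k _; rewrite !pser_partialE !big_mkord mulr_suml.
  by apply: eq_bigr => n _; rewrite mulr_sumr.
rewrite exchange_big pser_partialE big_mkord mulr_sumr /=; apply: eq_bigr => n _.
rewrite exchange_big (bigD1 n) //= [X in _ + X]big1 ?addr0 => [|m mn].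
  under eq_bigr => k _ do rewrite /x mulrACA.
  rewrite -mulr_sumr sum_prim_root_ratio ?(leq_trans (ltn_ord _) MN) //.
  by rewrite eqxx muln1 expr1n mulr1 mulrC.
under eq_bigr => k _ do rewrite /x mulrACA.
rewrite -mulr_sumr sum_prim_root_ratio ?(leq_trans (ltn_ord _) MN) //.
by move: mn; rewrite eq_sym -val_eqE /= => /negPf ->; rewrite muln0 mulr0.
Qed.

(** Conjugation inverts a root of unity, so only powers of [w ^- k] with exponent
    [n + m <= 2M - 2 < N] occur, and all but [n = m = 0] average to zero. *)
Lemma mean_pser_partial_conj p t M : (0 < M)%N -> (M.*2 <= N.+1)%N ->
  \sum_(k < N) pser_partial p (w ^- k) M * conjc (pser_partial t (w ^+ k) M) =
  N%:R * (p 0%N * conjc (t 0%N)).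
Proof.
move=> M0 MN; pose x k n m := (p n * conjc (t m)) * ((w ^- k) ^+ (n + m) * (w ^+ k) ^+ 0).
transitivity (\sum_(k < N) \sum_(n < M) \sum_(m < M) x k n m).
  apply: eq_bigr => k _; rewrite !pser_partialE !big_mkord mulr_suml.
  apply: eq_bigr => n _; rewrite rmorph_sum mulr_sumr; apply: eq_bigr => m _ /=.
  rewrite /x rmorphM rmorphXn /= (@conjc_unit (w ^+ k)); last first.
    by rewrite (@normc_unity_root _ N) // -exprM mulnC exprM (prim_expr_order w_prim) expr1n.
  by rewrite mulrACA -exprD expr0 mulr1.
have sumx n m : (n < M)%N -> (m < M)%N ->
    \sum_(k < N) x k n m = p n * conjc (t m) * (N * (n + m == 0))%:R.
  move=> nM mM; rewrite -mulr_sumr sum_prim_root_ratio //.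
  by move: MN nM mM; rewrite -addnn; lia.
rewrite exchange_big (bigD1 (Ordinal M0)) //= [X in _ + X]big1 ?addr0 => [|n n0].
  rewrite exchange_big (bigD1 (Ordinal M0)) //= [X in _ + X]big1 ?addr0 => [|m m0].
    by rewrite sumx // ?addn0 /= muln1 mulrC.
  rewrite sumx // ?add0n (_ : (_ == _) = false) ?muln0 ?mulr0 //.
  by apply/negbTE.
rewrite exchange_big big1 // => m _; rewrite sumx // addn_eq0.
by rewrite (_ : (n == 0 :> nat) = false) ?muln0 ?mulr0 //; apply/negbTE.
Qed.

Lemma pser_partial_cst0 p u M : (0 < M)%N -> (forall n, p n.+1 = 0) ->
  pser_partial p u M = p 0%N.
Proof.
case: M => // M _ p0; rewrite pser_partialE big_nat_recl // big1 => [|n _].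
  by rewrite mulr1 addr0.
by rewrite p0 mul0r.
Qed.

Lemma mean_pser_partial p M : (0 < M)%N -> (M <= N)%N ->
  \sum_(k < N) pser_partial p (w ^+ k) M = N%:R * p 0%N.
Proof.
(* The first factor is taken to be the constant series 1. *)
move=> M0 MN; have := @mean_pser_partialM (fun n => (n == 0)%:R) p M MN.
rewrite [X in _ = _ * X]pser_partial_cst0 // => [|n]; last by rewrite mul0r.
rewrite eqxx mul1r => <-; apply: eq_bigr => k _.
by rewrite [X in _ = X * _]pser_partial_cst0 // mul1r.
Qed.

Lemma mean_pser_partialV p M : (0 < M)%N -> (M <= N)%N ->
  \sum_(k < N) pser_partial p (w ^- k) M = N%:R * p 0%N.
Proof.
move=> M0 MN; have := @mean_pser_partialM p (fun n => (n == 0)%:R) M MN.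
rewrite [X in _ = _ * X]pser_partial_cst0 // => [|n]; last by rewrite mulr0.
rewrite eqxx mulr1 => <-; apply: eq_bigr => k _.
by rewrite [X in _ = _ * X]pser_partial_cst0 // mulr1.
Qed.

End Averages.

Lemma prim_root_powV (w : R[i]) N k : N.-primitive_root w ->
  normc (w ^+ k) = 1 /\ conjc (w ^+ k) = w ^- k.
Proof.
move=> wp; have wk : normc (w ^+ k) = 1.
  by rewrite (@normc_unity_root _ N) ?(prim_order_gt0 wp) //
    -exprM mulnC exprM (prim_expr_order wp) expr1n.
by split => //; exact: conjc_unit.
Qed.

(* Sum [(Re p(w^-k) + e1) (Re t(w^k) + e2) >= 0] over the [2M]-th roots of unity,
   enough of them for the truncated sums to have no aliasing. *)
Lemma circle_conv_ge p t M (e1 e2 : R) : (0 < M)%N -> Im (t 0%N) = 0 ->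
  (forall u, normc u = 1 -> - e1 <= Re (pser_partial p u M)) ->
  (forall u, normc u = 1 -> - e2 <= Re (pser_partial t u M)) ->
  0 <= Re (pser_partial (fun n => p n * t n) 1 M) + Re (p 0%N * t 0%N) +
    2 * (e2 * Re (p 0%N) + e1 * Re (t 0%N) + e1 * e2).
Proof.
move=> M0 t0 hp ht; pose N := M.*2.
have N0 : (0 < N)%N by rewrite /N double_gt0.
have MN : (M <= N)%N by rewrite /N -addnn leq_addr.
have [w wp] := primitive_root_exists N0.
pose A k := Re (pser_partial p (w ^- k) M).
pose W k := Re (pser_partial t (w ^+ k) M).
have h1 : 0 <= \sum_(k < N) (A k + e1) * (W k + e2).
  apply: sumr_ge0 => k _; have [wk wkV] := prim_root_powV k wp.
  have wkV1 : normc (w ^- k) = 1 by rewrite normcV wk invr1.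
  by rewrite mulr_ge0 // -lerBlDr sub0r; [exact: hp|exact: ht].
have sW : \sum_(k < N) W k = N%:R * Re (t 0%N).
  by rewrite -Re_sum mean_pser_partial // -(rmorph_nat (real_complex R)) Re_realM.
have sA : \sum_(k < N) A k = N%:R * Re (p 0%N).
  by rewrite -Re_sum mean_pser_partialV // -(rmorph_nat (real_complex R)) Re_realM.
have tc : conjc (t 0%N) = t 0%N by move: t0; case: (t 0%N) => a b /= ->; rewrite oppr0.
have sAW : \sum_(k < N) A k * W k = N%:R * ((Re (pser_partial (fun n => p n * t n) 1 M) +
    Re (p 0%N * t 0%N)) / 2).
  under eq_bigr do rewrite /A /W ReM_ReM.
  rewrite -mulr_suml big_split -!Re_sum /= mean_pser_partialM // mean_pser_partial_conj //.
  by rewrite tc -(rmorph_nat (real_complex R)) !Re_realM -mulrDr mulrA.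
have h2 : \sum_(k < N) (A k + e1) * (W k + e2) =
    \sum_(k < N) A k * W k + e2 * \sum_(k < N) A k + e1 * (\sum_(k < N) W k) + N%:R * (e1 * e2).
  rewrite !mulr_sumr (mulr_natl (e1 * e2)) -[X in _ *+ X]card_ord -sumr_const -!big_split /=.
  by apply: eq_bigr => k _; ring.
have NR : 0 < N%:R :> R by rewrite ltr0n.
move: h1; rewrite h2 sAW sA sW.
set X := Re _; set Y := Re (_ * _); move=> h.
rewrite -(pmulr_rge0 _ NR) -(pmulr_rge0 _ (ltr0Sn R 0)); move: h; lra.
Qed.

End RootsOfUnity.

(** * Positivity of real parts under Hadamard products *)

Section PositiveRealPart.
Variable R : realType.
Implicit Types (p t : nat -> R[i]) (u z : R[i]).

(** The threshold on [M] is uniform in [u], since the roots of unity used later vary with [M]. *)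
Definition asymp_ge0 p : Prop := forall e : R, 0 < e ->
  \forall M \near \oo, forall u, normc u = 1 -> - e <= Re (pser_partial p u M).

Definition Re_ge0 p : Prop := forall z, normc z < 1 -> 0 <= Re (pser p z).

(** Dilation by [w] moves the unit circle into the open disk, where truncations converge
    uniformly. *)
Lemma asymp_ge0_dilate p w : disk_bounded p -> Re_ge0 p -> normc w < 1 ->
  asymp_ge0 (fun n => p n * w ^+ n).
Proof.
move=> bp p0 w1 e e0; apply: filterS (pser_partial_unif bp (normc_ge0 w) w1 e0).
move=> M hM u u1; have wu : normc (w * u) <= normc w by rewrite normcM u1 mulr1.
have -> : pser_partial (fun n => p n * w ^+ n) u M = pser_partial p (w * u) M.
  by rewrite !pser_partialE; apply: eq_bigr => n _; rewrite exprMn mulrA.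
have := Re_le_normc (pser p (w * u) - pser_partial p (w * u) M).
have := hM _ wu; have := p0 _ (le_lt_trans wu w1).
by rewrite ReB ler_norml => h1 h2 /andP[h3 h4]; lra.
Qed.

Lemma cvgC_cst u : cvgC (fun=> u) u.
Proof. by move=> e e0; near=> n; rewrite subrr normc0. Unshelve. all: by end_near. Qed.

Lemma circle_conv_lim p t l : asymp_ge0 p -> asymp_ge0 t -> Im (t 0%N) = 0 ->
  cvgC (pser_partial (fun n => p n * t n) 1) l -> 0 <= Re l + Re (p 0%N * t 0%N).
Proof.
move=> hp ht t0 cl; rewrite -ReD.
apply: (cvgC_Re_ge0 (cvgC_add cl (cvgC_cst (p 0%N * t 0%N)))) => e e0.
(* With both errors equal to [d <= 1], the error term of [circle_conv_ge] is at most [2 * d * K],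
   hence at most [e]. *)
pose K := `|Re (p 0%N)| + `|Re (t 0%N)| + 1; have K0 : 0 < K by rewrite ltr_wpDl.
pose d := Num.min 1 (e / (2 * K)).
have d0 : 0 < d by rewrite lt_min ltr01 divr_gt0 ?mulr_gt0.
have d1 : d <= 1 by rewrite ge_min lexx.
have dK : d * (2 * K) <= e by rewrite -ler_pdivlMr ?mulr_gt0 // ge_min lexx orbT.
near=> M.
have M0 : (0 < M)%N by near: M; exact: nbhs_infty_gt.
have h1 : forall u, normc u = 1 -> - d <= Re (pser_partial p u M).
  by near: M; exact: hp.
have h2 : forall u, normc u = 1 -> - d <= Re (pser_partial t u M).
  by near: M; exact: ht.
have := circle_conv_ge M0 t0 h1 h2; rewrite ReD.
have a1 := ler_wpM2l (ltW d0) (ler_norm (Re (p 0%N))).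
have a2 := ler_wpM2l (ltW d0) (ler_norm (Re (t 0%N))).
have a3 : d * d <= d * 1 by rewrite ler_wpM2l // ltW.
move: dK; rewrite /K; lra.
Unshelve. all: by end_near. Qed.

Lemma pser_partial_dilate p z M :
  pser_partial (fun n => p n * z ^+ n) 1 M = pser_partial p z M.
Proof. by rewrite !pser_partialE; apply: eq_bigr => n _; rewrite expr1n mulr1. Qed.

(** Write [z] as [(z / r) * r] with [normc z < r < 1]: [p] is dilated by [z / r] and [t] by [r], and
    both dilations stay inside the disk. *)
Lemma Re_ge0_conv p t z : disk_bounded p -> Re_ge0 p -> disk_bounded t -> Re_ge0 t ->
  Im (t 0%N) = 0 -> normc z < 1 ->
  0 <= Re (pser (fun n => p n * t n) z) + Re (p 0%N * t 0%N).
Proof.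
move=> bp p0 bt t0 it z1.
pose r := (1 + normc z) / 2; have z0 := normc_ge0 z.
have r1 : r < 1 by rewrite /r; lra.
have r0 : 0 < r by rewrite /r; lra.
have rC : r%:C != 0 by rewrite -normc_gt0 normc_real gtr0_norm.
have zr : normc (z / r%:C) < 1.
  by rewrite normcM normcV normc_real gtr0_norm // ltr_pdivrMr // mul1r /r; lra.
have r1C : normc r%:C < 1 by rewrite normc_real gtr0_norm.
have hp := asymp_ge0_dilate bp p0 zr; have ht := asymp_ge0_dilate bt t0 r1C.
have := circle_conv_lim hp ht; rewrite !expr0 !mulr1; apply=> //.
apply: eq_cvgC (disk_bounded_cvg (disk_boundedM bp bt) z1) => M.
rewrite -pser_partial_dilate !pser_partialE; apply: eq_bigr => n _.
by rewrite mulrACA -exprMn divfK.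
Qed.

(** The term [x n] lies in the [K - n] inner sums with [n <= j < K]; truncated subtraction gives 0
    once [n >= K]. *)
Lemma sum_mulrn_subn (V : nmodType) (x : nat -> V) K M : (K <= M)%N ->
  \sum_(0 <= n < M) x n *+ (K - n) = \sum_(0 <= j < K) \sum_(0 <= n < j.+1) x n.
Proof.
elim: K => [_|K IH KM]; first by rewrite [RHS]big_geq // big1.
rewrite big_nat_recr //= -IH 1?ltnW // (big_nat_widen _ _ _ _ _ KM) /=.
rewrite [X in _ + X]big_mkcond -big_split /=; apply: eq_bigr => n _.
have [nK|Kn] := ltnP n K.+1; first by rewrite subSn // mulrSr.
have /eqP -> : (K.+1 - n == 0)%N by rewrite subn_eq0.
have /eqP -> : (K - n == 0)%N by rewrite subn_eq0 ltnW.
by rewrite addr0.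
Qed.

(** Induction on [K]: in the square of the modulus of [S + u ^+ K], the cross term is the real part
    of [u^-1 + ... + u^-K], which equals that of [u + ... + u^K]. *)
Lemma fejer_kernel u K : normc u = 1 ->
  2 * \sum_(0 <= j < K) Re (\sum_(0 <= n < j.+1) u ^+ n) - K%:R =
  normc (\sum_(0 <= n < K) u ^+ n) ^+ 2.
Proof.
move=> u1; elim: K => [|K IH]; first by rewrite !big_geq // mulr0 subrr normc0 expr0n.
have sqrnormc x y : normc (x + y) ^+ 2 = normc x ^+ 2 + normc y ^+ 2 + 2 * Re (x * conjc y) :> R.
  have e v : normc v ^+ 2 = Re v ^+ 2 + Im v ^+ 2 :> R.
    by case: v => a b; rewrite sqr_sqrtr // addr_ge0 ?sqr_ge0.
  by rewrite !e; case: x y => [a b] [c d] /=; ring.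
rewrite [in RHS]big_nat_recr //= sqrnormc -IH normcX u1 expr1n.
have -> : Re ((\sum_(0 <= n < K) u ^+ n) * conjc (u ^+ K)) =
    Re (\sum_(0 <= n < K.+1) u ^+ n) - 1.
  rewrite [in RHS]big_nat_recl // expr0 ReD addrC addKr mulr_suml !Re_sum.
  rewrite big_nat_rev /= add0n; apply: eq_big_nat => n /andP[_ nK].
  have u0 : u != 0 by rewrite -normc_gt0 u1.
  have -> : u ^+ K = u ^+ (K - n.+1) * u ^+ n.+1 by rewrite -exprD subnK.
  rewrite rmorphM /= mulrA !conjc_unit ?normcX ?u1 ?expr1n //.
  by rewrite divff ?expf_neq0 // mul1r -conjc_unit ?normcX ?u1 ?expr1n // Re_conjc.
by rewrite [in LHS]big_nat_recr //= -natr1; ring.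
Qed.

Lemma Re_fejer_mean_ge0 p z K : disk_bounded p -> Re_ge0 p -> normc z < 1 ->
  0 <= \sum_(0 <= j < K) Re (pser_partial p z j.+1).
Proof.
(* These are the analytic coefficients of the Fejer kernel: [2 (K - n)] for [n > 0], but [K] at
   [n = 0]. *)
move=> bp p0 z1; pose t n : R[i] := 2 * (K - n)%:R - (n == 0)%:R * K%:R.
have sumt x M : (0 < M)%N -> (K <= M)%N -> \sum_(0 <= n < M) x n * t n =
    2 * \sum_(0 <= j < K) \sum_(0 <= n < j.+1) x n - x 0%N * K%:R.
  move=> M0 KM; rewrite -(sum_mulrn_subn _ KM) mulr_sumr.
  have -> : x 0%N * K%:R = \sum_(0 <= n < M) x n * ((n == 0)%:R * K%:R).
    case: M M0 {KM} => // M _; rewrite big_nat_recl // big1 ?addr0 ?mul1r // => n _.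
    by rewrite mul0r mulr0.
  by rewrite -sumrB; apply: eq_bigr => n _; rewrite /t -mulr_natr; ring.
have ht : asymp_ge0 t.
  move=> e e0; near=> M => u u1.
  have M0 : (0 < M)%N by near: M; exact: nbhs_infty_gt.
  have KM : (K <= M)%N by near: M; exact: nbhs_infty_ge.
  rewrite pser_partialE; under eq_bigr do rewrite mulrC.
  rewrite sumt // expr0 mul1r ReB.
  rewrite -!(rmorph_nat (real_complex R)) Re_realM /= Re_sum fejer_kernel //.
  by apply: le_trans (sqr_ge0 _); rewrite oppr_le0 ltW.
have t0 : t 0%N = K%:R by rewrite /t subn0 eqxx mul1r mulr_natl mulr2n addrK.
have it : Im (t 0%N) = 0 by rewrite t0 -(rmorph_nat (real_complex R)).
have := circle_conv_lim (asymp_ge0_dilate bp p0 z1) ht it.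
(* The subtracted [p 0%N * K%:R] cancels against the constant term added by [circle_conv_lim]. *)
move=> /(_ (2 * \sum_(0 <= j < K) pser_partial p z j.+1 - p 0%N * K%:R)).
rewrite expr0 mulr1 t0 -ReD subrK -(rmorph_nat (real_complex R)) Re_realM Re_sum pmulr_rge0 //.
apply=> e e0; near=> M.
have M0 : (0 < M)%N by near: M; exact: nbhs_infty_gt.
have KM : (K <= M)%N by near: M; exact: nbhs_infty_ge.
rewrite pser_partialE; under eq_bigr do rewrite expr1n mulr1.
by rewrite sumt // expr0 mulr1 (rmorph_nat (real_complex R)) subrr normc0.
Unshelve. all: by end_near. Qed.

(** Summation by parts twice: the second differences of [c] multiply the double sums of [x], and
    these nonnegative products are dropped, leaving the boundary terms. *)
Lemma abel_convex_ge (c x : nat -> R) N :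
  (forall n, c n.+1 - c n.+2 <= c n - c n.+1) ->
  (forall n, 0 <= \sum_(0 <= j < n) \sum_(0 <= k < j.+1) x k) ->
  c N * \sum_(0 <= k < N) x k +
    (c N - c N.+1) * \sum_(0 <= j < N) \sum_(0 <= k < j.+1) x k <=
  \sum_(0 <= k < N) c k * x k.
Proof.
move=> hc hx; elim: N => [|N IH]; first by rewrite !big_geq // !mulr0 addr0.
rewrite [leRHS]big_nat_recr //=; apply: le_trans (lerD IH (lexx _)).
have := ler_wpM2r (hx N.+1) (hc N).
rewrite [\sum_(0 <= j < N.+1) _]big_nat_recr //= [in X in X -> _]big_nat_recr //=.
rewrite big_nat_recr //=.
set S := \sum_(0 <= k < N) x k; set T := \sum_(0 <= j < N) _; lra.
Qed.

(** Of the two Abel boundary terms, one is a product of nonnegative factors by the Fejer means; the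
    other is asymptotically nonnegative because the partial sums approach [pser p z]. *)
Lemma Re_ge0_convex (c : nat -> R) p : (forall n, 0 <= c n) ->
  (forall n, c n.+1 <= c n) -> (forall n, c n.+1 - c n.+2 <= c n - c n.+1) ->
  disk_bounded p -> Re_ge0 p ->
  disk_bounded (fun n => (c n)%:C * p n) /\ Re_ge0 (fun n => (c n)%:C * p n).
Proof.
move=> c0 dc cc bp p0.
have c_le n : c n <= c 0%N by elim: n => // n; apply: le_trans.
have bcp : disk_bounded (fun n => (c n)%:C * p n).
  apply: disk_bounded_le (c0 0%N) _ bp => n.
  by rewrite normcM normc_real ger0_norm // ler_wpM2r ?normc_ge0.
split=> // z z1; apply: (cvgC_Re_ge0 (disk_bounded_cvg bcp z1)) => e e0.
(* The tolerance gets multiplied by [c N <= c 0%N]; adding 1 keeps the divisor positive. *)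
have C0 : 0 < c 0%N + 1 by have := c0 0%N; lra.
have d0 : 0 < e / (c 0%N + 1) by rewrite divr_gt0.
near=> N.
have SN : - (e / (c 0%N + 1)) <= Re (pser_partial p z N).
  have h : normc (pser_partial p z N - pser p z) < e / (c 0%N + 1).
    by near: N; exact: disk_bounded_cvg.
  have := Re_le_normc (pser_partial p z N - pser p z); have := p0 z z1.
  by rewrite ReB ler_norml => h1 /andP[h2 h3]; lra.
have hx n : 0 <= \sum_(0 <= j < n) \sum_(0 <= k < j.+1) Re (p k * z ^+ k).
  have := Re_fejer_mean_ge0 n bp p0 z1; congr (_ <= _).
  by apply: eq_bigr => j _; rewrite pser_partialE Re_sum.
rewrite pser_partialE Re_sum; under eq_bigr do rewrite -mulrA Re_realM.
apply: le_trans (abel_convex_ge N cc hx).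
rewrite -Re_sum -pser_partialE -[leLHS]addr0 lerD //; last first.
  by rewrite mulr_ge0 // subr_ge0.
have e1 : e / (c 0%N + 1) * (c 0%N + 1) = e by rewrite divfK ?gt_eqF.
move: (c_le N) (c0 N) (SN) (e1) (d0); set d := e / _; set S := Re _; nra.
Unshelve. all: by end_near. Qed.

End PositiveRealPart.

(** * Nonnegative, decreasing, convex real sequences *)

Section ConvexSequences.
Variable R : realType.
Implicit Types (f g : nat -> R).

Definition convex_decr f : Prop :=
  [/\ forall n, 0 <= f n, forall n, f n.+1 <= f n &
      forall n, f n.+1 - f n.+2 <= f n - f n.+1].

(** The second difference of a product is a sum of two products of first differences and two
    products of a middle value with a second difference, all nonnegative. *)
Lemma convex_decrM f g : convex_decr f -> convex_decr g ->
  convex_decr (fun n => f n * g n).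
Proof.
move=> [f0 fd fc] [g0 gd gc]; split=> n; first exact: mulr_ge0.
  exact: ler_pM.
have := mulr_ge0 (f0 n.+1) (_ : 0 <= (g n - g n.+1) - (g n.+1 - g n.+2)).
have := mulr_ge0 (g0 n.+1) (_ : 0 <= (f n - f n.+1) - (f n.+1 - f n.+2)).
have := mulr_ge0 (_ : 0 <= f n - f n.+1) (_ : 0 <= g n - g n.+1).
have := mulr_ge0 (_ : 0 <= f n.+1 - f n.+2) (_ : 0 <= g n.+1 - g n.+2).
rewrite !subr_ge0 => /(_ (fd _) (gd _)) h1 /(_ (fd _) (gd _)) h2 /(_ (fc _)) h3 /(_ (gc _)) h4.
lra.
Qed.

Lemma convex_decr_inv (x y : R) : 0 < x -> 0 <= y ->
  convex_decr (fun n => (x + n%:R * y)^-1).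
Proof.
move=> x0 y0; have h n : 0 < x + n%:R * y by rewrite ltr_wpDr // mulr_ge0.
split=> n; first by rewrite invr_ge0 ltW.
  by rewrite lef_pV2 ?posrE // lerD2l ler_wpM2r // ler_nat.
set u := x + n%:R * y; have u0 : 0 < u by exact: h.
have -> : x + n.+1%:R * y = u + y by rewrite /u -natr1; ring.
have -> : x + n.+2%:R * y = u + 2 * y by rewrite /u -!natr1; ring.
have u1 : 0 < u + y by lra.
have u2 : 0 < u + 2 * y by lra.
rewrite -subr_ge0.
have -> : u^-1 - (u + y)^-1 - ((u + y)^-1 - (u + 2 * y)^-1) =
    2 * y ^+ 2 * (u^-1 * (u + y)^-1 * (u + 2 * y)^-1).
  by field; rewrite ?gt_eqF.
by rewrite !mulr_ge0 ?sqr_ge0 ?invr_ge0 // ltW.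
Qed.

End ConvexSequences.

(** * Convexity of the reciprocal weights *)

Section Multiplier.
Variables (R : realType) (gamma delta lambda : R).

Local Notation W := (Lop_weight gamma delta).

Lemma Lop_weight_gt0 n : 0 < gamma -> gamma <= delta -> 0 < W n.
Proof.
move=> g0 gd; rewrite /Lop_weight divr_gt0 // mulr_gt0 ?exprn_gt0 //.
by rewrite ltr_wpDr ?mulr_ge0 ?subr_ge0 // mulr_gt0.
Qed.

(* Convexity at [0] would allow [1 / (gamma - lambda)] instead; the slack
   [2 / W 2] is what makes the final inequality strict. *)
Definition multiplier n : R :=
  if n is 0%N then (gamma - lambda)^-1 - 2 / W 2 else 2 / W n.

(** The factored form of the weight makes its reciprocal a product of three reciprocals of affine
    sequences. *)
Lemma convex_decr_weight : 0 < gamma -> gamma <= delta ->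
  convex_decr (fun n => 2 / W n).
Proof.
move=> g0 gd; have g20 : 0 < 2 * gamma by lra.
have d0 : 0 <= delta - gamma by lra.
have c1 := @convex_decr_inv R 1 1 ltr01 ler01.
have [h0 h1 h2] := convex_decrM (convex_decrM c1 c1) (convex_decr_inv g20 d0).
have e n : 2 / W n = 4 * ((1 + n%:R * 1)^-1 * (1 + n%:R * 1)^-1 *
     (2 * gamma + n%:R * (delta - gamma))^-1).
  rewrite mulr1 addrC natr1 /Lop_weight; field.
  by apply/andP; split; apply/lt0r_neq0; rewrite ltr_wpDr // mulr_ge0.
split=> n; rewrite !e.
- by rewrite mulr_ge0 // h0.
- by rewrite ler_pM2l // h1.
- by rewrite -!mulrBr ler_pM2l // h2.
Qed.

Lemma convex_decr_multiplier : 0 <= lambda -> lambda < gamma -> gamma <= delta ->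
  convex_decr multiplier.
Proof.
move=> l0 lg gd; have g0 : 0 < gamma by lra.
have [h0 h1 h2] := convex_decr_weight g0 gd.
(* Convexity at 0: the terms [2 / W 2] cancel, and what remains is
   [2 (gamma - lambda) <= gamma + delta]. *)
have k0 : 2 / W 1 - 2 / W 2 <= multiplier 0 - 2 / W 1.
  have -> : 2 / W 1 = (gamma + delta)^-1.
    by rewrite /Lop_weight; field; rewrite gt_eqF //; lra.
  have gd0 : 0 < gamma + delta by lra.
  have gl0 : 0 < gamma - lambda by lra.
  have : 2 / (gamma + delta) <= (gamma - lambda)^-1.
    by rewrite ler_pdivrMr // mulrC ler_pdivlMr //; lra.
  rewrite /multiplier; lra.
have k1 : 2 / W 1 <= multiplier 0 by have := h1 1; lra.
split=> [[|n]|[|n]|[|n]] //.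
- exact: le_trans k1.
- exact: h0.
- exact: h1.
- exact: h2.
Qed.

End Multiplier.

(** * From slices of the harmonic functions to their convolution *)

Section Main.
Variables (R : realType) (gamma delta lambda : R).
Implicit Types (a b : nat -> R[i]) (k z : R[i]).

Lemma unit_diskE z : unit_disk z = (normc z < 1) :> Prop.
Proof. by rewrite /unit_disk /= normrE -ltcR. Qed.

Lemma H0_disk_bounded a b : H0 a b -> disk_bounded a /\ disk_bounded b.
Proof.
by case=> _ _ _ _ h; split; apply: cvg_disk_bounded => z /h [].
Qed.

Lemma disk_bounded_H0 a b : a 0%N = 0 -> a 1%N = 1 -> b 0%N = 0 -> b 1%N = 0 ->
  disk_bounded a -> disk_bounded b -> H0 a b.
Proof.
move=> a0 a1 b0 b1 ba bb; split=> // z; rewrite unit_diskE => z1.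
have ca := disk_bounded_cvg ba z1; have cb := disk_bounded_cvg bb z1.
by split; apply/cvg_ex; [exists (pser a z)|exists (pser b z)]; apply/cvg_normcP.
Qed.

Definition const_coef (x : R[i]) n := if n is 0%N then x else 0.

Lemma disk_bounded_const_coef x : disk_bounded (const_coef x).
Proof.
by apply: disk_bounded_le ler01 _ (disk_bounded_cst x) => -[|n];
  rewrite mul1r ?normc0 ?normc_ge0.
Qed.

Lemma pser_const_coef x z : pser (const_coef x) z = x.
Proof.
apply: pser_lim => e e0; near=> n.
have n0 : (0 < n)%N by near: n; exact: nbhs_infty_gt.
by rewrite pser_partial_cst0 // subrr normc0.
Unshelve. all: by end_near. Qed.

Lemma pser_comb k a b x z : disk_bounded a -> disk_bounded b -> normc z < 1 ->
  disk_bounded (fun n => a n + k * b n + const_coef x n) /\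
  pser (fun n => a n + k * b n + const_coef x n) z = pser a z + k * pser b z + x.
Proof.
move=> ba bb z1; have bkb := disk_boundedZ k bb; have bx := disk_bounded_const_coef x.
have bakb := disk_boundedD ba bkb; split; first exact: disk_boundedD.
by rewrite (pserD bakb bx z1) (pserD ba bkb z1) pserZ // pser_const_coef.
Qed.

(** The coefficients of [P[s + k t]], with [P] as in the overview. *)
Definition slice k a b n := Lop_coef gamma delta a n + k * Lop_coef gamma delta b n +
  const_coef (- lambda%:C) n.

(* In [RH0], [Re] is [Num.Re], which takes its values in R[i]. *)
Lemma RH0_ReE (x y : R[i]) : ('Re `|x| < 'Re y) = (normc x < Re y).
Proof. by rewrite -!complexRe ltcR. Qed.

Lemma slice0 k a b : a 1%N = 1 -> b 1%N = 0 -> slice k a b 0 = (gamma - lambda)%:C.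
Proof.
move=> a1 b1; rewrite /slice /Lop_coef /= a1 b1 !mulr0 mulr1 addr0 rmorphB.
by congr (_ - _); congr (real_complex _ _); rewrite /Lop_weight; field.
Qed.

(** For [k] of modulus 1, the real part of [k] times the [b] term is at least minus its modulus,
    which the class condition outweighs. *)
Lemma RH0_slice k a b : normc k = 1 -> RH0 gamma delta lambda a b ->
  disk_bounded (slice k a b) /\ Re_ge0 (slice k a b).
Proof.
move=> k1 [h0 h]; have [ba bb] := H0_disk_bounded h0.
have bA := disk_bounded_Lop gamma delta ba; have bB := disk_bounded_Lop gamma delta bb.
have comb := pser_comb k (- lambda%:C) bA bB.
split; first by have [] := comb 0 (eq_ind_r (fun x => x < 1) ltr01 (normc0 R)).
move=> z z1; have [_ ->] := comb z z1; rewrite ReB ReD /=.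
have := h z; rewrite unit_diskE => /(_ z1); rewrite RH0_ReE ReB /= -!Lop_pser //.
have := Re_le_normc (k * Lop gamma delta (pser b) z); rewrite normcM k1 mul1r ler_norml.
by move=> /andP[h2 h3] h1; lra.
Qed.

Lemma RH0_conv_ge k a1 b1 a2 b2 z :
  0 <= lambda -> lambda < gamma -> gamma <= delta -> normc k = 1 ->
  RH0 gamma delta lambda a1 b1 -> RH0 gamma delta lambda a2 b2 -> normc z < 1 ->
  lambda < Re (Lop gamma delta (pser (hconv a1 a2)) z +
               k * Lop gamma delta (pser (hconv b1 b2)) z).
Proof.
move=> l0 lg gd k1 H1 H2 z1.
have g0 : 0 < gamma by lra.
have [ba1 bb1] := H0_disk_bounded (proj1 H1).
have [ba2 bb2] := H0_disk_bounded (proj1 H2).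
have [_ a11 _ b11 _] := proj1 H1; have [_ a21 _ b21 _] := proj1 H2.
have [c0 cd cc] := convex_decr_multiplier l0 lg gd.
pose c := multiplier gamma delta lambda.
(* The two values [s = 1] and [s = -1] are the two convolutions whose half sum gives the wanted
   one. *)
pose x s n := slice s a1 b1 n * ((c n)%:C * slice (s * k) a2 b2 n).
have conv s : normc s = 1 -> disk_bounded (x s) /\
    0 <= Re (pser (x s) z) + c 0%N * (gamma - lambda) ^+ 2.
  move=> s1; have sk1 : normc (s * k) = 1 by rewrite normcM s1 k1 mulr1.
  have [bp p0] := RH0_slice s1 H1; have [bt t0] := RH0_slice sk1 H2.
  have [bct ct0] := Re_ge0_convex c0 cd cc bt t0.
  split; first exact: disk_boundedM.
  have := Re_ge0_conv bp p0 bct ct0; rewrite !slice0 // -!rmorphM => /(_ z erefl z1).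
  by congr (_ <= _ + _); rewrite /= /c; ring.
have n1 : normc (-1 : R[i]) = 1 by rewrite normc_opp normc1.
have [bp hp] := conv 1 (normc1 R); have [bn hn] := conv (-1) n1.
have := addr_ge0 hp hn; rewrite addrACA -ReD -(pserD bp bn z1).
(* At index 0 the two products sum to [2 * (c 0%N * (gamma - lambda) ^+ 2)], while the operator
   contributes [4 * gamma]; [q] is the difference. *)
pose q : R := 2 * (c 0%N * (gamma - lambda) ^+ 2) - 4 * gamma.
have bA : disk_bounded (fun n => 4 * Lop_coef gamma delta (hconv a1 a2) n) :=
  disk_boundedZ 4 (disk_bounded_Lop gamma delta (disk_boundedM ba1 ba2)).
have bB : disk_bounded (Lop_coef gamma delta (hconv b1 b2)) :=
  disk_bounded_Lop gamma delta (disk_boundedM bb1 bb2).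
(* The cross terms cancel between [s = 1] and [s = -1]. For positive indices the factor [2 / W]
   removes one of the two weights, leaving 4 times the operator on the convolution. *)
have -> : (fun n => x 1 n + x (-1) n) = fun n =>
    4 * Lop_coef gamma delta (hconv a1 a2) n +
    4 * k * Lop_coef gamma delta (hconv b1 b2) n + const_coef q%:C n.
  apply/funext => -[|n].
    rewrite /x !slice0 // /const_coef /Lop_coef /hconv a11 a21 b11 b21 !mul0r !mulr0 !mulr1.
    have -> : Lop_weight gamma delta 0 = gamma by rewrite /Lop_weight; field.
    by rewrite addr0 /q !(rmorphM, rmorphD, rmorphB, rmorphXn, rmorph_nat) /=; ring.
  have w0 : (Lop_weight gamma delta n.+1)%:C != 0 :> R[i].
    by rewrite -normc_gt0 normc_real normr_gt0 gt_eqF // Lop_weight_gt0.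
  rewrite /x /slice /const_coef /Lop_coef /hconv /c /multiplier !addr0.
  have -> : (2 / Lop_weight gamma delta n.+1)%:C = 2 / (Lop_weight gamma delta n.+1)%:C :> R[i].
    by rewrite rmorphM fmorphV rmorph_nat.
  by move: w0; set w := _%:C => w0; field.
have [_ ->] := pser_comb (4 * k) q%:C bA bB z1.
have ba : disk_bounded (hconv a1 a2) by exact: disk_boundedM.
have bb : disk_bounded (hconv b1 b2) by exact: disk_boundedM.
have bLa := disk_bounded_Lop gamma delta ba.
rewrite pserZ // -!Lop_pser //.
set A := Lop _ _ _ z; set B := Lop _ _ _ z.
rewrite -mulrA -mulrDr ReD -(rmorph_nat (real_complex R)) Re_realM (_ : Re q%:C = q) // /q.
have gl0 : gamma - lambda != 0 by rewrite subr_eq0 gt_eqF.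
have W2 : 0 < 2 / Lop_weight gamma delta 2 * (gamma - lambda) ^+ 2.
  apply: mulr_gt0; first by rewrite divr_gt0 ?Lop_weight_gt0.
  by rewrite exprn_gt0 ?subr_gt0.
(* Inserting this value, the constants add up to [-4 * lambda] minus 4 times the positive quantity
   [W2], whence strictness. *)
have -> : c 0%N * (gamma - lambda) ^+ 2 =
    (gamma - lambda) - 2 / Lop_weight gamma delta 2 * (gamma - lambda) ^+ 2.
  by rewrite /c /multiplier mulrBl; congr (_ - _); field.
by move: W2; set w := _ * _; lra.
Qed.

End Main.

Theorem theorem16 (R : realType) (gamma delta lambda : R)
    (a1 b1 a2 b2 : nat -> R[i]) :
  0 <= lambda -> lambda < gamma -> gamma <= delta ->
  RH0 gamma delta lambda a1 b1 -> RH0 gamma delta lambda a2 b2 ->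
  RH0 gamma delta lambda (hconv a1 a2) (hconv b1 b2).
Proof.
move=> l0 lg gd H1 H2.
have [ba1 bb1] := H0_disk_bounded (proj1 H1).
have [ba2 bb2] := H0_disk_bounded (proj1 H2).
split.
  case: H1 H2 => [[a10 a11 b10 b11 _] _] [[a20 a21 b20 b21 _] _].
  apply: disk_bounded_H0; rewrite /hconv.
  - by rewrite a10 mul0r.
  - by rewrite a11 a21 mulr1.
  - by rewrite b10 mul0r.
  - by rewrite b11 mul0r.
  - exact: disk_boundedM.
  - exact: disk_boundedM.
move=> z; rewrite unit_diskE => z1; rewrite RH0_ReE ReB /=.
set M := Lop _ _ (pser (hconv b1 b2)) z.
(* The unit [k] rotates [M] onto the negative real axis, turning the bound on [Re] into one
   involving the modulus of [M]. *)
have [k k1 kM] : exists2 k, normc k = 1 & k * M = - (normc M)%:C.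
  have [->|M0] := eqVneq M 0.
    by exists 1; rewrite ?normc1 // normc0 mulr0 oppr0.
  have nM : (normc M)%:C != 0 :> R[i] by rewrite -normrE normr_eq0.
  exists (- ((normc M)%:C / M)); last by rewrite mulNr divfK.
  by rewrite normc_opp normcM normcV normc_real ger0_norm ?normc_ge0 //
    divff // gt_eqF // normc_gt0.
have := RH0_conv_ge l0 lg gd k1 H1 H2 z1; rewrite -/M kM ReB /=.
lra.
Qed.
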